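(* Let $h$ be an analytic function (on an open set containing $z_0 \in \mathbb{C}$), and let $z_0$ be an isolated zero of $f(z) = h(z) - \overline{z}$. (1) If $z_0$ is sense-reversing, then $\mathrm{ind}(f; z_0) = -1$. (2) If $z_0$ is sense-preserving, then $\mathrm{ind}(f; z_0) = +1$. (3) If $z_0$ is singular, then $\mathrm{ind}(f; z_0) \in \{-1, 0, +1\}$.
   Context: For $f(z) = h(z) - \overline{z}$ with $h$ analytic, a zero $z_0$ of $f$ is called sense-preserving if $|h'(z_0)| > 1$, sense-reversing if $|h'(z_0)| < 1$, and singular if $|h'(z_0)| = 1$. Winding: for a curve $\Gamma$ parametrized by a continuous $\gamma : [a,b] \to \mathbb{C}$ and a continuous function $f : \Gamma \to \mathbb{C}$ without zeros on $\Gamma$, the winding of $f$ on $\Gamma$ is $V(f;\Gamma) = \frac{1}{2\pi}[\arg(f(\gamma(b))) - \arg(f(\gamma(a)))]$, where $\arg(f\circ\gamma)$ is a continuous branch of the argument along $\gamma$. Poincaré index: if $f$ is continuous and nonzero in a punctured disk $\{z : 0 < |z - z_0| < R\}$, then $\mathrm{ind}(f; z_0) := V(f; \Gamma_r)\in\mathbb{Z}$, where $0 < r < R$ and $\Gamma_r$ is the positively oriented circle with center $z_0$ and radius $r$ (the value does not depend on $r$). *)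

(* Defs.v *)
From Stdlib Require Import Reals Lra ZArith.
From Coquelicot Require Import Coquelicot.

Open Scope R_scope.

(* The explicit structures force complex (rather than real) scalars in
   [is_pseries] and [is_derive]. *)
Definition analytic_at (h : C -> C) (w : C) : Prop :=
  exists (a : nat -> C) (r : R), 0 < r /\
    forall z : C, Cmod (z - w) < r ->
      @is_pseries C_AbsRing C_NormedModule a (z - w)%C (h z).

Definition analytic_on (U : C -> Prop) (h : C -> C) : Prop :=
  forall w : C, U w -> analytic_at h w.

Definition is_complex_derive (h : C -> C) (z0 d : C) : Prop :=
  @is_derive C_AbsRing C_NormedModule h z0 d.

(* Types of a point z0 assumed to be a zero of h(z) - conj z. *)
Definition sense_preserving (h : C -> C) (z0 : C) : Prop :=
  exists d : C, is_complex_derive h z0 d /\ Cmod d > 1.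

Definition sense_reversing (h : C -> C) (z0 : C) : Prop :=
  exists d : C, is_complex_derive h z0 d /\ Cmod d < 1.

Definition singular (h : C -> C) (z0 : C) : Prop :=
  exists d : C, is_complex_derive h z0 d /\ Cmod d = 1.

Definition isolated_zero (f : C -> C) (z0 : C) : Prop :=
  f z0 = 0%C /\
  exists rho : R, 0 < rho /\
    forall z : C, 0 < Cmod (z - z0) < rho -> f z <> 0%C.

Definition arg_branch (g : R -> C) (a b : R) (theta : R -> R) : Prop :=
  continuous_on (fun t => a <= t <= b) theta /\
  forall t : R, a <= t <= b ->
    g t = (Cmod (g t) * (cos (theta t), sin (theta t)))%C.

(* [is_winding f gamma a b v] : V(f; Gamma) is defined and equals v, where
   Gamma is parametrized by gamma on [a, b].  See [is_winding_unique]. *)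
Definition is_winding (f : C -> C) (gamma : R -> C) (a b v : R) : Prop :=
  a <= b /\
  continuous_on (fun t => a <= t <= b) gamma /\
  continuous_on (fun z => exists t, a <= t <= b /\ z = gamma t) f /\
  (forall t, a <= t <= b -> f (gamma t) <> 0%C) /\
  exists theta : R -> R,
    arg_branch (fun t => f (gamma t)) a b theta /\
    v = / (2 * PI) * (theta b - theta a).

Definition circle (z0 : C) (r : R) (t : R) : C :=
  (z0 + r * (cos t, sin t))%C.

(* [is_index f z0 n] : ind(f; z0) is defined and equals n.
   See [is_index_unique]. *)
Definition is_index (f : C -> C) (z0 : C) (n : Z) : Prop :=
  exists R0 : R, 0 < R0 /\
    (forall z : C, 0 < Cmod (z - z0) < R0 -> continuous f z /\ f z <> 0%C) /\
    (forall r : R, 0 < r < R0 ->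
       is_winding f (circle z0 r) 0 (2 * PI) (IZR n)).

Lemma is_winding_unique (f : C -> C) (gamma : R -> C) (a b v1 v2 : R) :
  is_winding f gamma a b v1 -> is_winding f gamma a b v2 -> v1 = v2.
Proof.
intros (ab & _ & _ & nz & th1 & [c1 e1] & ->) (_ & _ & _ & _ & th2 & [c2 e2] & ->).
f_equal.
set (cl := fun t => Rmax a (Rmin b t)).
assert (clin : forall t, a <= cl t <= b).
{ intros t; unfold cl; split; [apply Rmax_l|].
  apply Rmax_lub; [exact ab | apply Rmin_l]. }
assert (clid : forall t, a <= t <= b -> cl t = t).
{ intros t Ht; unfold cl; rewrite Rmin_right by lra; apply Rmax_right; lra. }
assert (clc : forall t : R, continuous cl t).
{ intros t; apply continuity_pt_filterlim.
  intros eps Heps; exists eps; split; [exact Heps|].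
  simpl; unfold R_dist, cl; intros x [_ Hx].
  apply Rle_lt_trans with (2 := Hx).
  unfold Rmax, Rmin; repeat destruct Rle_dec;
    unfold Rabs; repeat destruct Rcase_abs; lra. }
assert (ext : forall th : R -> R, continuous_on (fun t => a <= t <= b) th ->
  forall t : R, continuous (fun s : R => th (cl s) : R) t).
{ intros th cth t; unfold continuous.
  eapply filterlim_comp; [|apply (cth (cl t) (clin t))].
  intros P HP; generalize (clc t _ HP); unfold filtermap.
  apply filter_imp; intros s Hs; apply Hs, clin. }
set (d := fun t => th1 (cl t) - th2 (cl t)).
assert (dc : continuity d).
{ intros t; apply continuity_pt_minus; apply continuity_pt_filterlim; now apply ext. }
assert (cosd : forall t, cos (d t) = 1).
{ intros t; unfold d; set (s := cl t).
  assert (Hs : a <= s <= b) by apply clin.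
  generalize (e1 s Hs) (e2 s Hs) (nz s Hs).
  generalize (f (gamma s)); intros w E1 E2 nw.
  assert (m : Cmod w <> 0) by (intro H; apply nw, Cmod_eq_0, H).
  rewrite E1 in E2 at 1.
  injection E2; intros Es Ec; ring_simplify in Es; ring_simplify in Ec.
  apply Rmult_eq_reg_l in Es; [|exact m]; apply Rmult_eq_reg_l in Ec; [|exact m].
  rewrite cos_minus, Es, Ec; generalize (sin2_cos2 (th2 s)).
  unfold Rsqr; lra. }
destruct (Req_dec (d a) (d b)) as [H|H].
{ unfold d in H; rewrite !clid in H by lra; lra. }
exfalso.
assert (P := PI_RGT_0).
set (e := Rmin PI (Rabs (d b - d a))).
assert (epos : 0 < e <= PI).
{ unfold e; split; [apply Rmin_glb_lt; [lra | apply Rabs_pos_lt; lra] | apply Rmin_l]. }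
assert (eab : e <= Rabs (d b - d a)) by apply Rmin_r.
assert (ce : cos e < 1) by (rewrite <- cos_0; apply cos_decreasing_1; lra).
assert (sda : sin (d a) = 0).
{ generalize (sin2_cos2 (d a)); rewrite cosd; unfold Rsqr; intros; nra. }
assert (key : exists t, d t = d a + e \/ d t = d a - e).
{ destruct (Rle_dec (d a) (d b)) as [L|L].
  - rewrite Rabs_right in eab by lra.
    destruct (IVT_gen d a b (d a + e) dc) as [t [_ Ht]].
    { rewrite Rmin_left, Rmax_right; lra. }
    exists t; left; exact Ht.
  - rewrite Rabs_left in eab by lra.
    destruct (IVT_gen d a b (d a - e) dc) as [t [_ Ht]].
    { rewrite Rmin_right, Rmax_left; lra. }
    exists t; right; exact Ht. }
destruct key as [t [Ht|Ht]]; generalize (cosd t); rewrite Ht.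
- rewrite cos_plus, cosd, sda; lra.
- rewrite cos_minus, cosd, sda; lra.
Qed.

Lemma is_index_unique (f : C -> C) (z0 : C) (n1 n2 : Z) :
  is_index f z0 n1 -> is_index f z0 n2 -> n1 = n2.
Proof.
intros (R1 & p1 & _ & w1) (R2 & p2 & _ & w2); apply eq_IZR.
assert (M : 0 < Rmin R1 R2) by (apply Rmin_glb_lt; assumption).
assert (M1 := Rmin_l R1 R2); assert (M2 := Rmin_r R1 R2).
apply (is_winding_unique f (circle z0 (Rmin R1 R2 / 2)) 0 (2 * PI));
  [apply w1 | apply w2]; lra.
Qed.

(* Main.v *)
(** An analytic [h] is strictly differentiable at [z0]: with [c = h'(z0)], the map
    [h z - c * z] is Lipschitz near [z0] with arbitrarily small constant.  If
    [|c| < 1], on small circles [f] is closer to [- Cconj (z - z0)] than the size of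
    the latter, and if [|c| > 1] it is so close to [c * (z - z0)]; this gives the
    indices -1 and +1.  If [|c| = 1], rotate the variable and the value so that [f]
    becomes [G u = u - Cconj u + (small Lipschitz)].  The zero set of the imaginary
    part of [G] is then the graph of a Lipschitz function of [x = Re u], so by
    isolation of the zero the real part of [G] has a constant sign on each of its
    two halves [x > 0] and [x < 0].  These two signs determine whether [G] turns
    like 1, like [u], or like [- Cconj u]. *)

Require Import Defs.
From Stdlib Require Import Reals ZArith Lra Ranalysis5.
From Coquelicot Require Import Coquelicot.

Open Scope R_scope.

(** * Strict differentiability of power series *)

(** Induction on [n] through [x * x^m - y * y^m = x * (x^m - y^m) + y^m * (x - y)] with [m = n + 1].
    The difference is stated for exponent [S n] so that the derivative's exponent needs no
    subtraction. *)
Lemma Cmod_pow_n_sub (x y : C) (rho : R) (n : nat) :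
  Cmod x <= rho -> Cmod y <= rho ->
  Cmod (pow_n x n) <= rho ^ n /\
  Cmod (pow_n x (S n) - pow_n y (S n)) <= INR (S n) * rho ^ n * Cmod (x - y).
Proof.
intros Hx Hy.
assert (P : forall (z : C) m, Cmod z <= rho -> Cmod (pow_n z m) <= rho ^ m).
{ intros z m Hz; induction m as [|m IH].
  - simpl; change (Cmod (RtoC 1) <= 1); rewrite Cmod_1; lra.
  - change (Cmod (z * pow_n z m) <= rho * rho ^ m); rewrite Cmod_mult.
    apply Rmult_le_compat; auto using Cmod_ge_0. }
split; [now apply P|].
assert (rho0 : 0 <= rho) by (apply Rle_trans with (2 := Hx), Cmod_ge_0).
induction n as [|n IH].
- change (pow_n x 1) with (x * RtoC 1)%C; change (pow_n y 1) with (y * RtoC 1)%C.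
  simpl (INR 1); simpl (rho ^ 0).
  replace (x * RtoC 1 - y * RtoC 1)%C with (x - y)%C by ring; lra.
- change (pow_n x (S (S n))) with (x * pow_n x (S n))%C.
  change (pow_n y (S (S n))) with (y * pow_n y (S n))%C.
  replace (x * pow_n x (S n) - y * pow_n y (S n))%C
    with (x * (pow_n x (S n) - pow_n y (S n)) + pow_n y (S n) * (x - y))%C by ring.
  eapply Rle_trans; [apply Cmod_triangle|]; rewrite !Cmod_mult.
  rewrite (S_INR (S n)).
  replace ((INR (S n) + 1) * rho ^ S n * Cmod (x - y))
    with (rho * (INR (S n) * rho ^ n * Cmod (x - y)) + rho ^ S n * Cmod (x - y))
    by (simpl pow; ring).
  apply Rplus_le_compat.
  + apply Rmult_le_compat; auto using Cmod_ge_0.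
  + apply Rmult_le_compat_r; auto using Cmod_ge_0.
Qed.

(** Partial sums of a convergent series are bounded, and each later term is a difference of two
    consecutive ones, hence at most twice their bound. This stands in for Cauchy's estimates. *)
Lemma pseries_coeff_bound (a : nat -> C) (x l : C) :
  @is_pseries C_AbsRing C_NormedModule a x l ->
  exists M, 0 < M /\ forall n, Cmod (a n) * Cmod x ^ n <= M.
Proof.
intros H.
destruct (@filterlim_bounded C_AbsRing C_NormedModule _ (ex_intro _ l H)) as [M HM].
assert (HM' : forall n, Cmod (sum_n (fun k => scal (pow_n x k) (a k) : C_NormedModule) n) <= M).
{ exact HM. }
assert (M0 : 0 <= M) by (eapply Rle_trans; [apply Cmod_ge_0 | apply (HM' O)]).
exists (2 * M + 1); split; [lra|].
assert (T : forall n, Cmod (a n) * Cmod x ^ n = Cmod (pow_n x n * a n)).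
{ intros n; rewrite Cmod_mult, Rmult_comm; f_equal.
  induction n as [|n IH].
  - change (1 = Cmod (RtoC 1)); now rewrite Cmod_1.
  - change (Cmod x * Cmod x ^ n = Cmod (x * pow_n x n)); now rewrite Cmod_mult, IH. }
intros [|n]; rewrite T.
- generalize (HM' O); rewrite sum_O.
  change (Cmod (pow_n x O * a O) <= M -> Cmod (pow_n x O * a O) <= 2 * M + 1); lra.
- generalize (HM' n) (HM' (S n)); rewrite sum_Sn.
  set (s := sum_n _ n).
  change (Cmod s <= M -> Cmod (s + pow_n x (S n) * a (S n)) <= M ->
    Cmod (pow_n x (S n) * a (S n)) <= 2 * M + 1).
  set (t := (pow_n x (S n) * a (S n))%C); intros H1 H2.
  replace t with ((s + t) + (- s))%C by ring.
  eapply Rle_trans; [apply Cmod_triangle|]; rewrite Cmod_opp; lra.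
Qed.

(* With [k <= 2 ^ k] and [q <= 1/4], the [k]-th term [k q ^ (k-1)] is at most
   [16 q / 2 ^ k]; the bound below telescopes these. *)
Lemma partial_sum_strict_bound (a : nat -> C) (s M q : R) (x y : C) (n : nat) :
  0 < s -> 0 <= q <= / 4 -> (forall n, Cmod (a n) * s ^ n <= M) ->
  Cmod x <= q * s -> Cmod y <= q * s ->
  let S_ z := sum_n (fun k => scal (pow_n z k) (a k) : C_NormedModule) (S n) in
  Cmod (S_ x - S_ y - a 1%nat * (x - y))
    <= M / s * q * (8 - 8 / 2 ^ n) * Cmod (x - y).
Proof.
intros s0 [q0 q4] HM Hx Hy; cbv zeta.
assert (M0 : 0 <= M).
{ eapply Rle_trans; [|apply (HM O)]; simpl; generalize (Cmod_ge_0 (a O)); lra. }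
induction n as [|n IH].
(* For the sums up to index 1, constant and linear terms cancel exactly, and the right side is 0 as
   well. *)
- rewrite !sum_Sn, !sum_O.
  match goal with |- Cmod ?u <= _ => replace u with (RtoC 0) end.
  + rewrite Cmod_0; simpl; right; field; lra.
  + change (RtoC 0 = (RtoC 1 * a 0%nat + x * RtoC 1 * a 1%nat)
      - (RtoC 1 * a 0%nat + y * RtoC 1 * a 1%nat) - a 1%nat * (x - y))%C; ring.
- rewrite !(sum_Sn _ (S n)).
  revert IH; set (sx := sum_n _ (S n)); set (sy := sum_n (fun k => scal (pow_n y k) (a k)) (S n)).
  change (Cmod (sx - sy - a 1%nat * (x - y)) <= M / s * q * (8 - 8 / 2 ^ n) * Cmod (x - y) ->
    Cmod ((sx + pow_n x (S (S n)) * a (S (S n))) - (sy + pow_n y (S (S n)) * a (S (S n)))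
          - a 1%nat * (x - y)) <= M / s * q * (8 - 8 / 2 ^ S n) * Cmod (x - y)).
  intros IH.
  match goal with |- Cmod ?u <= _ =>
    replace u with ((sx - sy - a 1%nat * (x - y))
      + a (S (S n)) * (pow_n x (S (S n)) - pow_n y (S (S n))))%C by ring end.
  eapply Rle_trans; [apply Cmod_triangle|]; rewrite Cmod_mult.
  destruct (Cmod_pow_n_sub x y (q * s) (S n) Hx Hy) as [_ D].
  assert (p2 : 0 < 2 ^ n) by (apply pow_lt; lra).
  assert (ps : 0 < s ^ n) by (apply pow_lt; lra).
  (* From [n + 2 <= 2 ^ (n + 2)] and [q ^ n <= 1 / 4 ^ n]. *)
  assert (E : INR (S (S n)) * q ^ S n <= q * (4 / 2 ^ n)).
  { assert (q ^ n <= (/ 4) ^ n) by (apply pow_incr; lra).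
    assert (N : INR (S (S n)) <= 2 ^ S (S n)).
    { clear; generalize (S (S n)) as m; induction m as [|m IH]; [simpl; lra|].
      rewrite S_INR; simpl; generalize (pow_R1_Rle 2 m); lra. }
    apply Rle_trans with (2 ^ S (S n) * (q * (/ 4) ^ n)).
    - apply Rmult_le_compat; [apply pos_INR| |exact N|].
      + apply pow_le, q0.
      + simpl; apply Rmult_le_compat_l; assumption.
    - simpl; rewrite pow_inv.
      replace (4 ^ n) with (2 ^ n * 2 ^ n).
      + right; field; lra.
      + rewrite <- Rpow_mult_distr; f_equal; lra. }
  (* The increment of [8 - 8 / 2 ^ n] from [n] to [n + 1] is exactly [4 / 2 ^ n]. *)
  replace (M / s * q * (8 - 8 / 2 ^ S n) * Cmod (x - y))
    with (M / s * q * (8 - 8 / 2 ^ n) * Cmod (x - y)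
          + M / s * (q * (4 / 2 ^ n)) * Cmod (x - y)) by (simpl; field; lra).
  apply Rplus_le_compat; [exact IH|].
  apply Rle_trans with (M / s * (INR (S (S n)) * q ^ S n) * Cmod (x - y)).
  2: { apply Rmult_le_compat_r; [apply Cmod_ge_0|].
       apply Rmult_le_compat_l; [|exact E].
       apply Rdiv_le_0_compat; lra. }
  apply Rle_trans with
    (Cmod (a (S (S n))) * (INR (S (S n)) * (q * s) ^ S n * Cmod (x - y))).
  { apply Rmult_le_compat_l; [apply Cmod_ge_0 | exact D]. }
  rewrite Rpow_mult_distr.
  replace (Cmod (a (S (S n))) * (INR (S (S n)) * (q ^ S n * s ^ S n) * Cmod (x - y)))
    with ((Cmod (a (S (S n))) * s ^ S (S n)) * (/ s * (INR (S (S n)) * q ^ S n) * Cmod (x - y)))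
    by (simpl; field; lra).
  replace (M / s * (INR (S (S n)) * q ^ S n) * Cmod (x - y))
    with (M * (/ s * (INR (S (S n)) * q ^ S n) * Cmod (x - y))) by (field; lra).
  apply Rmult_le_compat_r; [|apply HM].
  apply Rmult_le_pos; [|apply Cmod_ge_0].
  apply Rmult_le_pos; [left; now apply Rinv_0_lt_compat|].
  apply Rmult_le_pos; [apply pos_INR | apply pow_le, q0].
Qed.

(** The bound on partial sums is uniform in their length, so it passes to the limit; shrinking the
    disk by the factor [q] brings its constant below [eps]. *)
Lemma analytic_strict_derivative (h : C -> C) (w : C) :
  analytic_at h w ->
  exists c : C, forall eps : R, 0 < eps -> exists delta : R, 0 < delta /\
    forall z z' : C, Cmod (z - w) < delta -> Cmod (z' - w) < delta ->
      Cmod (h z - h z' - c * (z - z')) <= eps * Cmod (z - z').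
Proof.
intros (a & r & r0 & Ha).
exists (a 1%nat); intros eps eps0.
set (s := r / 2).
assert (s0 : 0 < s) by (unfold s; lra).
destruct (pseries_coeff_bound a s (h (w + s)%C)) as (M & M0 & HM).
{ replace (RtoC s) with ((w + s) - w)%C at 1 by ring.
  apply Ha; replace (w + s - w)%C with (RtoC s) by ring.
  rewrite Cmod_R, Rabs_right; unfold s; lra. }
rewrite Cmod_R, Rabs_right in HM by lra.
assert (Ms : 0 < M / s) by now apply Rdiv_lt_0_compat.
(* The first bound is what the partial sum estimate requires; the second gives
   [8 * (M / s) * q <= eps]. *)
set (q := Rmin (/ 4) (eps / (8 * (M / s)))).
assert (q0 : 0 < q).
{ apply Rmin_glb_lt; [lra|]; apply Rdiv_lt_0_compat; lra. }
assert (q4 : q <= / 4) by apply Rmin_l.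
assert (qe : M / s * q * 8 <= eps).
{ assert (q <= eps / (8 * (M / s))) by apply Rmin_r.
  replace eps with (M / s * (eps / (8 * (M / s))) * 8) by (field; lra).
  apply Rmult_le_compat_r; [lra|]; apply Rmult_le_compat_l; lra. }
assert (qs : q * s < r) by (unfold s; nra).
exists (q * s); split; [now apply Rmult_lt_0_compat|].
intros z z' Hz Hz'.
assert (L : forall y, Cmod (y - w) < q * s -> filterlim
   (sum_n (fun k => scal (pow_n (y - w)%C k) (a k) : C_NormedModule))
   eventually (@locally C_NormedModule (h y))).
{ intros y Hy; apply Ha; lra. }
set (T := fun y n => sum_n (fun k => scal (pow_n (y - w)%C k) (a k) : C_NormedModule) n).
assert (lim : is_lim_seq (fun n => Cmod (T z n - T z' n - a 1%nat * (z - z')))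
   (Cmod (h z - h z' - a 1%nat * (z - z')))).
{ apply (filterlim_ext
    (fun n => @norm C_AbsRing C_NormedModule
      (plus (plus (T z n) (opp (T z' n))) (opp (a 1%nat * (z - z'))%C)))).
  { reflexivity. }
  eapply filterlim_comp; [|apply (@filterlim_norm C_AbsRing C_NormedModule)].
  eapply filterlim_comp_2; [|apply filterlim_const|
    apply (@filterlim_plus C_AbsRing C_NormedModule)].
  eapply filterlim_comp_2; [apply (L z Hz)| |
    apply (@filterlim_plus C_AbsRing C_NormedModule)].
  eapply filterlim_comp; [apply (L z' Hz')|].
  apply (@filterlim_opp C_AbsRing C_NormedModule). }
(* The estimate concerns sums up to index [S n], hence the shifted sequence. *)
apply is_lim_seq_incr_1 in lim.
apply (is_lim_seq_le _ (fun _ => eps * Cmod (z - z')) _ _) with (2 := lim)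
  (3 := is_lim_seq_const _).
intros n.
replace (z - z')%C with ((z - w) - (z' - w))%C by ring.
eapply Rle_trans.
{ apply (partial_sum_strict_bound a s M q); auto; lra. }
apply Rmult_le_compat_r; [apply Cmod_ge_0|].
apply Rle_trans with (2 := qe).
apply Rmult_le_compat_l; [apply Rmult_le_pos; lra|].
assert (0 < 8 / 2 ^ n); [|lra].
apply Rdiv_lt_0_compat; [lra | apply pow_lt; lra].
Qed.

(** Fixing [z' = w] turns strict differentiability into the ordinary one. This identifies the [d] in
    the three types of zeros with the constant of the Lipschitz estimate. *)
Lemma strict_derivative_unique (h : C -> C) (w c d : C) :
  (forall eps : R, 0 < eps -> exists delta : R, 0 < delta /\
    forall z z' : C, Cmod (z - w) < delta -> Cmod (z' - w) < delta ->
      Cmod (h z - h z' - c * (z - z')) <= eps * Cmod (z - z')) ->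
  is_complex_derive h w d -> c = d.
Proof.
intros Hc Hd.
assert (Hc' : @is_derive C_AbsRing C_NormedModule h w c).
{ split; [apply is_linear_scal_l|].
  intros x Hx eps; apply (@is_filter_lim_locally_unique C_AbsRing (AbsRing_NormedModule C_AbsRing)) in Hx; subst x.
  destruct (Hc eps (cond_pos eps)) as (delta & d0 & D).
  exists (mkposreal delta d0); intros z Hz.
  change (Cmod (z - w) < delta) in Hz.
  assert (W : Cmod (w - w) < delta).
  { replace (w - w)%C with (RtoC 0) by ring; rewrite Cmod_0; exact d0. }
  specialize (D z w Hz W).
  rewrite (Cmult_comm c) in D. exact D. }
apply is_C_derive_unique in Hc'; apply is_C_derive_unique in Hd; congruence.
Qed.

(** * Turning of closed paths *)

(** Convertible with the pairs written out in [arg_branch] and [circle]. *)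
Definition cis (t : R) : C := (cos t, sin t).

Lemma cis_plus (a b : R) : cis (a + b) = (cis a * cis b)%C.
Proof.
unfold cis, Cmult; simpl; rewrite cos_plus, sin_plus; f_equal; ring.
Qed.

Lemma Cmod_cis (t : R) : Cmod (cis t) = 1.
Proof.
unfold Cmod, cis; simpl.
replace (cos t * (cos t * 1) + sin t * (sin t * 1)) with 1; [apply sqrt_1|].
generalize (sin2_cos2 t); unfold Rsqr; lra.
Qed.

Lemma Cmod_sqr_components (z : C) : Cmod z * Cmod z = fst z * fst z + snd z * snd z.
Proof.
unfold Cmod; rewrite sqrt_sqrt; [ring|].
generalize (pow2_ge_0 (fst z)) (pow2_ge_0 (snd z)); lra.
Qed.

(** The sum vanishes exactly on the closed negative real axis, so its positivity describes the slit
    plane; off the real axis [Cmod z] exceeds the absolute value of [fst z]. *)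
Lemma Cmod_plus_fst_pos (z : C) :
  (snd z = 0 -> 0 < fst z) -> 0 < Cmod z + fst z.
Proof.
intros H; generalize (Cmod_sqr_components z) (Cmod_ge_0 z); intros E P.
destruct (Req_dec (snd z) 0) as [Z|Z]; [specialize (H Z); lra|].
destruct (Rlt_dec 0 (Cmod z + fst z)) as [L|L]; [exact L | exfalso].
assert (0 < snd z * snd z) by (now apply Rlt_0_sqr).
nra.
Qed.

(* The half-angle formula gives the principal argument on the slit plane in a
   form whose continuity is immediate. *)
Definition slit_arg (z : C) : R := 2 * atan (snd z / (Cmod z + fst z)).

(** With [N = Cmod z], [s = y / (N + x)] is the tangent of half the angle, and
    [1 + s * s = 2 * N / (N + x)]; the double-angle formulas then return [x / N] and [y / N]. *)
Lemma slit_arg_spec (z : C) :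
  0 < Cmod z + fst z -> z = (Cmod z * cis (slit_arg z))%C.
Proof.
intros H; unfold slit_arg.
assert (E := Cmod_sqr_components z); revert H E.
destruct z as [x y]; generalize (Cmod (x, y)); simpl; intros N H E.
set (s := y / (N + x)).
assert (N0 : 0 < N) by nra.
assert (S1 : 1 + s * s = 2 * N / (N + x)).
{ unfold s; apply Rmult_eq_reg_r with ((N + x) * (N + x)); [|nra].
  field_simplify; [nra | lra | lra]. }
assert (Hs : 0 < 1 + s * s) by nra.
assert (cs : cos (atan s) * cos (atan s) * (1 + s * s) = 1).
{ rewrite cos_atan; unfold Rsqr.
  replace (1 / sqrt (1 + s * s) * (1 / sqrt (1 + s * s)))
    with (/ (sqrt (1 + s * s) * sqrt (1 + s * s))).
  - rewrite sqrt_sqrt by lra; field; lra.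
  - field; apply Rgt_not_eq, sqrt_lt_R0; lra. }
assert (sn : sin (atan s) = s * cos (atan s)).
{ rewrite sin_atan, cos_atan; unfold Rsqr; field; apply Rgt_not_eq, sqrt_lt_R0; lra. }
assert (K : cos (atan s) * cos (atan s) = (N + x) / (2 * N)).
{ apply Rmult_eq_reg_r with (1 + s * s); [|lra]; rewrite cs, S1; field; lra. }
unfold cis, Cmult; simpl; rewrite cos_2a, sin_2a, sn.
f_equal.
- replace (cos (atan s) * cos (atan s) - s * cos (atan s) * (s * cos (atan s)))
    with (2 * (cos (atan s) * cos (atan s)) - cos (atan s) * cos (atan s) * (1 + s * s)) by ring.
  rewrite cs, K; field; lra.
- replace (2 * (s * cos (atan s)) * cos (atan s))
    with (2 * s * (cos (atan s) * cos (atan s))) by ring.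
  rewrite K; unfold s; field; lra.
Qed.

(** The points outside the slit plane form the closed negative real axis, origin included, where the
    angle [PI] serves. *)
Lemma polar_form (z : C) : exists t : R, z = (Cmod z * cis t)%C.
Proof.
destruct (Rlt_dec 0 (Cmod z + fst z)) as [L|L].
{ exists (slit_arg z); now apply slit_arg_spec. }
exists PI.
assert (S : snd z = 0).
{ destruct (Req_dec (snd z) 0) as [S|S]; [exact S|].
  exfalso; apply L, Cmod_plus_fst_pos; intros; contradiction. }
assert (F : fst z = - Cmod z).
{ generalize (Cmod_sqr_components z) (Cmod_ge_0 z); rewrite S; intros; nra. }
revert S F; destruct z as [x y]; generalize (Cmod (x, y)); simpl; intros N -> ->.
unfold cis, Cmult; simpl; rewrite cos_PI, sin_PI; f_equal; ring.
Qed.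

(** Stated by components so that the continuity lemmas for real functions apply. *)
Definition path_continuous (F : R -> C) : Prop :=
  continuity (fun t => fst (F t)) /\ continuity (fun t => snd (F t)).

Lemma path_continuous_const (c : C) : path_continuous (fun _ => c).
Proof. split; apply continuity_const; now intros x y. Qed.

Lemma path_continuous_mult (F G : R -> C) :
  path_continuous F -> path_continuous G -> path_continuous (fun t => (F t * G t)%C).
Proof.
intros [f1 f2] [g1 g2]; split; intros t; simpl.
- apply continuity_pt_minus; now apply continuity_pt_mult.
- apply continuity_pt_plus; now apply continuity_pt_mult.
Qed.

Lemma path_continuous_conj (F : R -> C) :
  path_continuous F -> path_continuous (fun t => Cconj (F t)).
Proof.
intros [f1 f2]; split; [exact f1|]; intros t; simpl; now apply continuity_pt_opp.
Qed.

Lemma path_continuous_cis : path_continuous cis.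
Proof. split; [apply continuity_cos | apply continuity_sin]. Qed.

Lemma continuity_Cmod (F : R -> C) :
  path_continuous F -> continuity (fun t => Cmod (F t)).
Proof.
intros [f1 f2] t; unfold Cmod.
apply (continuity_pt_comp (fun t => fst (F t) ^ 2 + snd (F t) ^ 2) sqrt).
- simpl; apply continuity_pt_plus; repeat apply continuity_pt_mult; auto;
    apply continuity_pt_const; now intros x y.
- apply continuity_pt_sqrt.
  generalize (pow2_ge_0 (fst (F t))) (pow2_ge_0 (snd (F t))); lra.
Qed.

(** [T] is in radians, that is, [2 * PI] times a winding. The lift is required on the whole line,
    which spares side conditions on [t]. *)
Definition turning (F : R -> C) (a b T : R) : Prop :=
  exists theta : R -> R, continuity theta /\
    (forall t, F t = (Cmod (F t) * cis (theta t))%C) /\ theta b - theta a = T.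

Lemma turning_ext (F G : R -> C) (a b T : R) :
  (forall t, F t = G t) -> turning F a b T -> turning G a b T.
Proof.
intros E (th & c & e & d); exists th; repeat split; [exact c| |exact d].
intros t; rewrite <- E; apply e.
Qed.

Lemma turning_scale (c : C) (F : R -> C) (a b T : R) :
  turning F a b T -> turning (fun t => (c * F t)%C) a b T.
Proof.
intros (th & ct & e & d); destruct (polar_form c) as [al Hal].
exists (fun t => al + th t); repeat split.
- intros t; apply continuity_pt_plus; [|apply ct].
  apply continuity_pt_const; now intros x y.
- intros t; rewrite cis_plus, Cmod_mult, RtoC_mult.
  rewrite Hal at 1; rewrite (e t) at 1; ring.
- rewrite <- d; ring.
Qed.

Lemma turning_const (c : C) (a b : R) : turning (fun _ => c) a b 0.
Proof.
destruct (polar_form c) as [al Hal].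
exists (fun _ => al); repeat split; [|intros _; exact Hal|ring].
apply continuity_const; now intros x y.
Qed.

Lemma turning_cis (r : R) : 0 < r ->
  turning (fun t => (r * cis t)%C) 0 (2 * PI) (2 * PI).
Proof.
intros r0; exists (fun t => t); repeat split; [|intros t|ring].
- apply derivable_continuous, derivable_id.
- rewrite Cmod_mult, Cmod_cis, Cmod_R, Rabs_right, Rmult_1_r by lra; reflexivity.
Qed.

Lemma turning_conj (F : R -> C) (a b T : R) :
  turning F a b T -> turning (fun t => Cconj (F t)) a b (- T).
Proof.
intros (th & ct & e & d).
exists (fun t => - th t); repeat split.
- intros t; apply continuity_pt_opp, ct.
- intros t; rewrite Cmod_conj; rewrite (e t) at 1.
  unfold cis, Cconj, Cmult; simpl; rewrite cos_neg, sin_neg; f_equal; ring.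
- rewrite <- d; ring.
Qed.

(* The hypothesis on [s] says that [F t] never points opposite to [G t], so the
   quotient [F / G] stays in the slit plane, where the argument is single-valued. *)
Lemma turning_compare (F G : R -> C) (a b T : R) :
  path_continuous F -> path_continuous G -> F a = F b -> G a = G b ->
  (forall t, G t <> 0%C) ->
  (forall t s, 0 <= s -> (F t + s * G t)%C <> 0%C) ->
  turning G a b T -> turning F a b T.
Proof.
intros cF cG pF pG G0 opp (th & cth & eth & dth).
(* The product with the conjugate has the argument of [F / G] and avoids a division. *)
set (q := fun t => (F t * Cconj (G t))%C).
assert (cq : path_continuous q).
{ apply path_continuous_mult; [exact cF | now apply path_continuous_conj]. }
assert (qG : forall t, (q t * G t)%C = (F t * (Cmod (G t) * Cmod (G t)))%C).
{ intros t; unfold q; rewrite <- RtoC_mult, Cmod_sqr_components.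
  destruct (F t) as [x y], (G t) as [u v]; unfold Cconj, Cmult, RtoC; simpl; f_equal; ring. }
assert (G1 : forall t, 0 < Cmod (G t)) by (intros t; apply Cmod_gt_0, G0).
assert (N : forall t, RtoC (Cmod (G t)) <> 0%C).
{ intros t E; injection E; generalize (G1 t); lra. }
assert (slit : forall t, 0 < Cmod (q t) + fst (q t)).
{ intros t; apply Cmod_plus_fst_pos; intros S.
  destruct (Rlt_dec 0 (fst (q t))) as [L|L]; [exact L|exfalso].
  assert (P : 0 < Cmod (G t) * Cmod (G t)) by (apply Rmult_lt_0_compat; apply G1).
  (* If [q t] is real and nonpositive, then [F t] is [q t / Cmod (G t) ^ 2] times [G t], a
     nonpositive multiple. *)
  apply (opp t (- fst (q t) / (Cmod (G t) * Cmod (G t)))).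
  { apply Rdiv_le_0_compat; lra. }
  assert (Q : q t = RtoC (fst (q t))).
  { unfold RtoC; rewrite <- S; now destruct (q t). }
  replace (F t) with (q t * G t / (Cmod (G t) * Cmod (G t)))%C
    by (rewrite qG; field; exact (N t)).
  unfold Rdiv; rewrite RtoC_mult, RtoC_inv, RtoC_opp, RtoC_mult, <- Q.
  field; exact (N t).
  lra. }
(* [slit_arg] is a function of [q t] alone and [q a = q b], so only [th] contributes to the total
   change. *)
exists (fun t => slit_arg (q t) + th t); repeat split.
- intros t; apply continuity_pt_plus; [|apply cth].
  unfold slit_arg.
  apply continuity_pt_mult; [apply continuity_pt_const; now intros x y|].
  apply (continuity_pt_comp (fun t => snd (q t) / (Cmod (q t) + fst (q t))) atan).
  + apply continuity_pt_div; [apply cq| |generalize (slit t); lra].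
    apply continuity_pt_plus; [now apply continuity_Cmod | apply cq].
  + apply derivable_continuous_pt, derivable_pt_atan.
- intros t.
  assert (E : (F t * (Cmod (G t) * Cmod (G t)))%C =
    (Cmod (F t) * cis (slit_arg (q t) + th t) * (Cmod (G t) * Cmod (G t)))%C).
  { rewrite <- qG, (slit_arg_spec _ (slit t)) at 1.
    rewrite (eth t) at 1; rewrite cis_plus.
    replace (Cmod (q t)) with (Cmod (F t) * Cmod (G t)).
    - rewrite RtoC_mult; ring.
    - unfold q; now rewrite Cmod_mult, Cmod_conj. }
  replace (F t) with (F t * (Cmod (G t) * Cmod (G t)) / (Cmod (G t) * Cmod (G t)))%C at 1
    by (field; exact (N t)).
  rewrite E; field; exact (N t).
- unfold q; rewrite pF, pG, <- dth; ring.
Qed.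

(** Rouché's principle: if [F t = - s * G t] with [s >= 0], then [F t - G t] has modulus
    [(1 + s) * Cmod (G t)], which is too large. *)
Lemma turning_near (F G : R -> C) (a b T : R) :
  path_continuous F -> path_continuous G -> F a = F b -> G a = G b ->
  (forall t, Cmod (F t - G t) < Cmod (G t)) ->
  turning G a b T -> turning F a b T.
Proof.
intros cF cG pF pG near; apply turning_compare; auto.
- intros t E; specialize (near t); rewrite E, Cmod_0 in near.
  generalize (Cmod_ge_0 (F t - 0)); lra.
- intros t s s0 E.
  specialize (near t); revert near.
  replace (F t - G t)%C with ((F t + s * G t) - RtoC (1 + s) * G t)%C
    by (rewrite RtoC_plus; ring).
  rewrite E; replace (0 - RtoC (1 + s) * G t)%C with (- (RtoC (1 + s) * G t))%C by ring.
  rewrite Cmod_opp, Cmod_mult, Cmod_R, Rabs_right by lra.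
  generalize (Cmod_ge_0 (G t)); nra.
Qed.

(** * From turning along circles to the index *)

Lemma turning_arg_branch (F : R -> C) (a b T : R) :
  turning F a b T -> exists theta, arg_branch F a b theta /\ theta b - theta a = T.
Proof.
intros (th & c & e & d); exists th; repeat split; [|intros t _; apply e|exact d].
apply continuous_on_forall; intros t _; apply continuity_pt_filterlim, c.
Qed.

Lemma path_continuous_continuous (F : R -> C) (t : R) :
  path_continuous F -> continuous F t.
Proof.
intros [f1 f2].
apply (continuous_ext (fun t => (fst (F t), snd (F t)))); [intros x; now destruct (F x)|].
apply (continuous_comp_2 (fun t => fst (F t)) (fun t => snd (F t)) (fun x y : R => (x, y))).
- apply continuity_pt_filterlim, f1.
- apply continuity_pt_filterlim, f2.
- apply (continuous_ext (fun z : R * R => z)); [now intros [x y] | apply continuous_id].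
Qed.

Lemma continuous_path_continuous (f : C -> C) (G : R -> C) :
  path_continuous G -> (forall t, continuous f (G t)) ->
  path_continuous (fun t => f (G t)).
Proof.
intros cG cf.
assert (c : forall t, continuous (fun t => f (G t)) t).
{ intros t; apply (continuous_comp G f); [now apply path_continuous_continuous | apply cf]. }
split; intros t; apply continuity_pt_filterlim.
- apply (continuous_comp (fun t => f (G t)) (fun z : R * R => fst z)); [apply c|].
  destruct (f (G t)); apply continuous_fst.
- apply (continuous_comp (fun t => f (G t)) (fun z : R * R => snd z)); [apply c|].
  destruct (f (G t)); apply continuous_snd.
Qed.

Lemma path_continuous_circle (z0 : C) (r : R) : path_continuous (circle z0 r).
Proof.
assert (c : path_continuous (fun t => (r * cis t)%C)).
{ apply path_continuous_mult; [apply path_continuous_const | apply path_continuous_cis]. }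
destruct c as [c1 c2]; split; intros t.
- apply (continuity_pt_plus (fun _ => fst z0)); [|apply c1].
  apply continuity_pt_const; now intros x y.
- apply (continuity_pt_plus (fun _ => snd z0)); [|apply c2].
  apply continuity_pt_const; now intros x y.
Qed.

Lemma Cmod_circle (z0 : C) (r t : R) : 0 <= r -> Cmod (circle z0 r t - z0) = r.
Proof.
intros r0; unfold circle; fold (cis t).
replace (z0 + r * cis t - z0)%C with (r * cis t)%C by ring.
rewrite Cmod_mult, Cmod_cis, Cmod_R, Rabs_right; lra.
Qed.

Lemma circle_2PI (z0 : C) (r : R) : circle z0 r 0 = circle z0 r (2 * PI).
Proof. unfold circle; now rewrite cos_0, sin_0, cos_2PI, sin_2PI. Qed.

Lemma is_index_of_turning (f : C -> C) (z0 : C) (R0 : R) (n : Z) :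
  0 < R0 ->
  (forall z, 0 < Cmod (z - z0) < R0 -> continuous f z /\ f z <> 0%C) ->
  (forall r, 0 < r < R0 ->
    turning (fun t => f (circle z0 r t)) 0 (2 * PI) (2 * PI * IZR n)) ->
  is_index f z0 n.
Proof.
intros R0pos Hf Ht; exists R0; split; [exact R0pos|]; split; [exact Hf|].
intros r Hr.
assert (P := PI_RGT_0).
assert (on : forall t, continuous f (circle z0 r t) /\ f (circle z0 r t) <> 0%C).
{ intros t; apply Hf; rewrite Cmod_circle; lra. }
split; [lra|]; split; [|split; [|split]].
- apply continuous_on_forall; intros t _.
  apply path_continuous_continuous, path_continuous_circle.
- apply continuous_on_forall; intros z (t & _ & ->); apply on.
- intros t _; apply on.
- destruct (turning_arg_branch _ _ _ _ (Ht r Hr)) as (th & b & d).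
  exists th; split; [exact b|]; rewrite d; field; lra.
Qed.

(** * The singular case *)

Lemma lipschitz_continuity_pt (f : R -> R) (x d K : R) :
  0 < d -> 0 < K ->
  (forall y, Rabs (y - x) < d -> Rabs (f y - f x) <= K * Rabs (y - x)) ->
  continuity_pt f x.
Proof.
intros d0 K0 H eps eps0.
exists (Rmin d (eps / K)); split.
{ apply Rmin_glb_lt; [exact d0 | now apply Rdiv_lt_0_compat]. }
simpl; unfold R_dist; intros y [_ Hy].
assert (Hd := Rlt_le_trans _ _ _ Hy (Rmin_l _ _)).
assert (He := Rlt_le_trans _ _ _ Hy (Rmin_r _ _)).
apply Rle_lt_trans with (1 := H y Hd).
replace eps with (K * (eps / K)) by (field; lra).
now apply Rmult_lt_compat_l.
Qed.

(* [Y] is close to [2 y], so its zero set is the graph of a Lipschitz function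
   of [x]; over [x > 0] this graph is connected and [X] does not vanish on it. *)
Lemma zero_set_constant_sign (X Y : R -> R -> R) (rho : R) :
  Y 0 0 = 0 ->
  (forall x y x' y', Rabs x < rho -> Rabs y < rho -> Rabs x' < rho -> Rabs y' < rho ->
    Rabs (X x y - X x' y') <= / 2 * (Rabs (x - x') + Rabs (y - y')) /\
    Rabs (Y x y - Y x' y' - 2 * (y - y')) <= / 2 * (Rabs (x - x') + Rabs (y - y'))) ->
  (forall x y, 0 < x < rho -> Rabs y < rho -> Y x y = 0 -> X x y <> 0) ->
  exists sigma : R, (sigma = 1 \/ sigma = -1) /\
    forall x y, 0 < x < rho -> Rabs y < rho -> Y x y = 0 -> 0 < sigma * X x y.
Proof.
intros Y0 L NZ.
assert (small : forall x y, 0 < x < rho -> Rabs y <= x -> Rabs x < rho /\ Rabs y < rho).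
{ intros x y Hx Hy; rewrite (Rabs_right x) by lra; lra. }
(* The range condition sits inside the subset type, so that [g] below is a total function; outside
   the range its value is the default 0. *)
assert (graph : forall x, {y | 0 < x < rho -> Rabs y <= x /\ Y x y = 0}).
{ intros x.
  destruct (Rlt_dec 0 x) as [x0|x0]; [|exists 0; intros; lra].
  destruct (Rlt_dec x rho) as [x1|x1]; [|exists 0; intros; lra].
  assert (B : forall y, Rabs y <= x ->
    Rabs (Y x y - 2 * y) <= / 2 * (x + Rabs y)).
  { intros y Hy; destruct (small x y) as [sx sy]; [lra | exact Hy|].
    destruct (L x y 0 0) as [_ H]; auto; try (rewrite Rabs_R0; lra).
    rewrite Y0, !Rminus_0_r, (Rabs_right x) in H by lra; exact H. }
  (* At [y = x] and [y = - x], [B] puts [Y x y] within [x] of [2 * y], so the signs at the two ends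
     are opposite. *)
  destruct (IVT_interv (fun y => Y x y) (- x) x) as (y & Hy & E).
  - intros y Hy.
    (* The constant is 2 from the linear part plus 1/2 from the remainder. *)
    apply (lipschitz_continuity_pt _ _ (rho - Rabs y) (5 / 2)).
    + assert (Rabs y <= x) by (apply Rabs_le; lra); lra.
    + lra.
    + intros z Hz.
      assert (Hy' : Rabs y <= x) by (apply Rabs_le; lra).
      assert (Rabs z < rho) by (generalize (Rabs_triang (z - y) y);
        replace (z - y + y) with z by ring; lra).
      destruct (small x y) as [sx sy]; [lra | exact Hy'|].
      destruct (L x z x y) as [_ H']; auto.
      revert H'; replace (x - x) with 0 by ring; rewrite Rabs_R0.
      unfold Rabs; repeat destruct Rcase_abs; lra.
  - lra.
  - assert (H := B (- x)); revert H; rewrite Rabs_Ropp, (Rabs_right x) by lra.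
    intros H; specialize (H (Rle_refl x)); revert H.
    unfold Rabs; destruct Rcase_abs; lra.
  - assert (H := B x); revert H; rewrite (Rabs_right x) by lra.
    intros H; specialize (H (Rle_refl x)); revert H.
    unfold Rabs; destruct Rcase_abs; lra.
  - exists y; intros _; split; [apply Rabs_le; lra | exact E]. }
(* For two zeros, [2 * (y - y')] is bounded by half of the sum of both distances, so the slope is
   even at most 1/3. The case [x = x'] gives uniqueness of the zero over [x]. *)
assert (lip : forall x y x' y', 0 < x < rho -> 0 < x' < rho -> Rabs y < rho -> Rabs y' < rho ->
  Y x y = 0 -> Y x' y' = 0 -> Rabs (y - y') <= Rabs (x - x')).
{ intros x y x' y' Hx Hx' Hy Hy' E E'.
  destruct (L x y x' y') as [_ H]; auto; try (rewrite Rabs_right; lra).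
  revert H; rewrite E, E'; unfold Rabs; repeat destruct Rcase_abs; lra. }
set (g := fun x => proj1_sig (graph x)).
assert (Hg : forall x, 0 < x < rho -> Rabs (g x) < rho /\ Y x (g x) = 0).
{ intros x Hx; unfold g; destruct (graph x) as (y & Hy); simpl.
  destruct (Hy Hx); split; [lra | assumption]. }
assert (gu : forall x y, 0 < x < rho -> Rabs y < rho -> Y x y = 0 -> y = g x).
{ intros x y Hx Hy E; destruct (Hg x Hx) as [H1 H2].
  assert (H := lip x y x (g x) Hx Hx Hy H1 E H2); revert H.
  replace (x - x) with 0 by ring; rewrite Rabs_R0.
  unfold Rabs; destruct Rcase_abs; lra. }
(* [X] along the graph: continuous and without zeros on the interval, hence of one sign, which is
   read off at [rho / 2]. *)
set (k := fun x => X x (g x)).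
assert (kc : forall x, 0 < x < rho -> continuity_pt k x).
{ intros x Hx.
  apply (lipschitz_continuity_pt _ _ (Rmin x (rho - x)) 1); [apply Rmin_glb_lt; lra | lra|].
  intros x' Hx'.
  assert (D1 := Rlt_le_trans _ _ _ Hx' (Rmin_l _ _)).
  assert (D2 := Rlt_le_trans _ _ _ Hx' (Rmin_r _ _)).
  assert (Hx'2 : 0 < x' < rho) by (revert D1 D2; unfold Rabs; destruct Rcase_abs; lra).
  destruct (Hg x Hx) as [H1 H2], (Hg x' Hx'2) as [H1' H2'].
  assert (H := lip x' (g x') x (g x) Hx'2 Hx H1' H1 H2' H2).
  destruct (L x' (g x') x (g x)) as [H' _]; auto; try (rewrite Rabs_right; lra).
  unfold k; lra. }
assert (knz : forall x, 0 < x < rho -> k x <> 0).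
{ intros x Hx; destruct (Hg x Hx); now apply NZ. }
assert (same : forall x x', 0 < x < rho -> 0 < x' < rho -> 0 < k x -> k x' < 0 -> False).
{ assert (opp : forall x, 0 < x < rho -> continuity_pt (fun t => - k t) x).
  { intros x Hx; now apply continuity_pt_opp, kc. }
  intros x x' Hx Hx' P N.
  destruct (Rtotal_order x x') as [l|[->|l]]; [|lra|].
  - destruct (IVT_interv (fun t => - k t) x x') as (z & Hz & E); [|lra..|].
    + intros; apply opp; lra.
    + apply (knz z); lra.
  - destruct (IVT_interv k x' x) as (z & Hz & E); [|lra..|].
    + intros; apply kc; lra.
    + apply (knz z); lra. }
destruct (Rlt_dec 0 rho) as [r0|r0].
2: { exists 1; split; [now left | intros; lra]. }
assert (mid : 0 < rho / 2 < rho) by lra.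
destruct (Rtotal_order 0 (k (rho / 2))) as [S|[S|S]].
- exists 1; split; [now left|]; intros x y Hx Hy E.
  rewrite (gu x y Hx Hy E); fold (k x).
  destruct (Rtotal_order 0 (k x)) as [T|[T|T]]; [lra| |].
  + now destruct (knz x Hx).
  + destruct (same (rho / 2) x); assumption.
- now destruct (knz (rho / 2) mid).
- exists (-1); split; [now right|]; intros x y Hx Hy E.
  rewrite (gu x y Hx Hy E); fold (k x).
  destruct (Rtotal_order 0 (k x)) as [T|[T|T]]; [| |lra].
  + destruct (same x (rho / 2)); assumption.
  + now destruct (knz x Hx).
Qed.

(* The index is [(sp - sm) / 2], where [sp] and [sm] are the signs of [fst G] at the
   zeros of [snd G] on the right and on the left.  When they differ, one first deforms
   [fst G] to [sp * x] with [snd G] fixed, then [snd G] to [y] with [sp * x] fixed. *)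
Lemma turning_near_fold (G : C -> C) (rho : R) :
  G (RtoC 0) = RtoC 0 -> 0 < rho ->
  (forall u u' : C, Cmod u < 2 * rho -> Cmod u' < 2 * rho ->
    Cmod (G u - G u' - ((u - Cconj u) - (u' - Cconj u'))) <= / 2 * Cmod (u - u')) ->
  (forall u : C, 0 < Cmod u < 2 * rho -> G u <> RtoC 0) ->
  exists m : R, (m = -1 \/ m = 0 \/ m = 1) /\
    forall p : R -> C,
      (forall t, 0 < Cmod (p t) < rho) -> path_continuous p ->
      path_continuous (fun t => G (p t)) -> p 0 = p (2 * PI) ->
      turning p 0 (2 * PI) (2 * PI) ->
      turning (fun t => G (p t)) 0 (2 * PI) (2 * PI * m).
Proof.
intros G0 r0 L NZ.
set (X := fun x y => fst (G (x, y))); set (Y := fun x y => snd (G (x, y))).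
assert (comp : forall z : C, Rabs (fst z) <= Cmod z /\ Rabs (snd z) <= Cmod z).
{ intros z; split; eapply Rle_trans; [apply Rmax_l | apply Rmax_Cmod
  | apply Rmax_r | apply Rmax_Cmod]. }
(* Places the square of half-side [rho] inside the disk of radius [2 * rho] on which [L] and [NZ]
   hold. *)
assert (l1 : forall x y : R, Cmod (x, y) <= Rabs x + Rabs y).
{ intros x y; replace (x, y) with (RtoC x + Ci * RtoC y)%C.
  - eapply Rle_trans; [apply Cmod_triangle|].
    rewrite Cmod_mult, !Cmod_R; unfold Ci, Cmod; simpl.
    replace (0 * (0 * 1) + 1 * (1 * 1)) with 1 by ring; rewrite sqrt_1; lra.
  - unfold Ci, RtoC, Cmult, Cplus; simpl; f_equal; ring. }
(* The linear part [u - Cconj u] is [2 * y] times the imaginary unit: it adds nothing to [X] and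
   [2 * y] to [Y]. *)
assert (LXY : forall x y x' y', Rabs x < rho -> Rabs y < rho -> Rabs x' < rho -> Rabs y' < rho ->
    Rabs (X x y - X x' y') <= / 2 * (Rabs (x - x') + Rabs (y - y')) /\
    Rabs (Y x y - Y x' y' - 2 * (y - y')) <= / 2 * (Rabs (x - x') + Rabs (y - y'))).
{ intros x y x' y' Hx Hy Hx' Hy'.
  assert (H := L (x, y) (x', y')).
  assert (H1 := l1 x y); assert (H2 := l1 x' y').
  specialize (H ltac:(lra) ltac:(lra)).
  assert (H3 : Cmod ((x, y) - (x', y'))%C <= Rabs (x - x') + Rabs (y - y')) by apply l1.
  match type of H with Cmod ?z <= _ => destruct (comp z) as [C1 C2] end.
  simpl in C1, C2; fold (X x y) (X x' y') (Y x y) (Y x' y') in *.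
  split.
  - replace (X x y - X x' y')
      with (X x y + - X x' y' + - (x + - x + - (x' + - x'))) by ring; lra.
  - replace (Y x y - Y x' y' - 2 * (y - y'))
      with (Y x y + - Y x' y' + - (y + - - y + - (y' + - - y'))) by ring; lra. }
assert (Y0 : Y 0 0 = 0) by (unfold Y; fold (RtoC 0); rewrite G0; reflexivity).
assert (nz : forall x y, x <> 0 -> Rabs x < rho -> Rabs y < rho -> Y x y = 0 -> X x y <> 0).
{ intros x y Hx Hx' Hy E E'; apply (NZ (x, y)).
  - split; [|generalize (l1 x y); lra].
    apply Cmod_gt_0; intros H; injection H; lra.
  - rewrite (surjective_pairing (G (x, y))); fold (X x y) (Y x y); now rewrite E, E'. }
destruct (zero_set_constant_sign X Y rho Y0 LXY) as (sp & Hsp & P).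
{ intros x y Hx; apply nz; [lra | rewrite Rabs_right; lra]. }
(* The left half is reflected onto the right one. *)
destruct (zero_set_constant_sign (fun x => X (- x)) (fun x => Y (- x)) rho) as (sm & Hsm & M).
{ now rewrite Ropp_0. }
{ intros x y x' y' Hx Hy Hx' Hy'.
  replace (Rabs (x - x')) with (Rabs (- x - - x'))
    by (rewrite <- Rabs_Ropp; f_equal; ring).
  apply LXY; auto; now rewrite Rabs_Ropp. }
{ intros x y Hx; apply nz; [lra | rewrite Rabs_Ropp, Rabs_right; lra]. }
(* Comparison with the origin: on the axis [x = 0], [Y] has the sign of [y]. *)
assert (cone : forall x y, Rabs x < rho -> Rabs y < rho -> Rabs (Y x y - 2 * y) <= / 2 * (Rabs x + Rabs y)).
{ intros x y Hx Hy; destruct (LXY x y 0 0) as [_ H]; auto; try (rewrite Rabs_R0; lra).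
  now rewrite Y0, !Rminus_0_r in H. }
assert (box : forall p : R -> C, (forall t, 0 < Cmod (p t) < rho) -> forall t,
  Rabs (fst (p t)) < rho /\ Rabs (snd (p t)) < rho /\
  G (p t) = (X (fst (p t)) (snd (p t)), Y (fst (p t)) (snd (p t))) /\
  (fst (p t) = 0 -> snd (p t) <> 0)).
{ intros p Hp t; destruct (comp (p t)); specialize (Hp t).
  repeat split; [lra..| |].
  - unfold X, Y; rewrite <- (surjective_pairing (p t)); apply surjective_pairing.
  - intros H1 H2; assert (E : p t = RtoC 0) by (rewrite (surjective_pairing (p t)), H1, H2; reflexivity).
    rewrite E, Cmod_0 in Hp; lra. }
assert (cross : forall p : R -> C, (forall t, 0 < Cmod (p t) < rho) -> forall t,
  Y (fst (p t)) (snd (p t)) = 0 ->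
  0 < fst (p t) /\ 0 < sp * X (fst (p t)) (snd (p t)) \/
  fst (p t) < 0 /\ 0 < sm * X (fst (p t)) (snd (p t))).
{ intros p Hp t E; destruct (box p Hp t) as (Hx & Hy & _ & N).
  revert Hx Hy N E; generalize (fst (p t)) (snd (p t)); intros x y Hx Hy N E.
  destruct (Rtotal_order x 0) as [l|[->|l]].
  - right; split; [exact l|].
    rewrite <- (Ropp_involutive x) at 1; apply M; rewrite ?Ropp_involutive; auto.
    rewrite Rabs_left in Hx; lra.
  - exfalso; generalize (cone 0 y Hx Hy); rewrite E, Rabs_R0.
    generalize (N eq_refl); unfold Rabs; repeat destruct Rcase_abs; lra.
  - left; split; [exact l|]; apply P; auto; rewrite Rabs_right in Hx; lra. }
(* With equal signs, [G] meets the real axis only on the side of [sp], so it never points opposite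
   to that constant. *)
destruct (Req_dec sp sm) as [S|S].
- exists 0; split; [tauto|]; intros p Hp cp cG per _; rewrite Rmult_0_r.
  apply (turning_compare _ (fun _ => RtoC sp)); auto.
  + apply path_continuous_const.
  + now rewrite per.
  + intros _ H; injection H; lra.
  + intros t s s0; destruct (box p Hp t) as (_ & _ & -> & _); intros H.
    injection H; intros H1 H2; assert (E := cross p Hp t).
    revert E H1 H2; generalize (X (fst (p t)) (snd (p t))) (Y (fst (p t)) (snd (p t))).
    intros; subst sm; destruct Hsp; subst sp; nra.
  + apply turning_const.
- exists sp; split; [tauto|]; intros p Hp cp cG per tp.
  assert (E : sm = - sp) by (destruct Hsp, Hsm; lra).
  set (F := fun t => (sp * fst (p t), snd (p t)) : C).
  set (F' := fun t => (sp * fst (p t), snd (G (p t))) : C).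
  assert (cx : continuity (fun t => sp * fst (p t))).
  { intros t; apply continuity_pt_mult; [apply continuity_pt_const; now intros x y | apply cp]. }
  assert (cF : path_continuous F) by (split; [exact cx | apply cp]).
  assert (cF' : path_continuous F') by (split; [exact cx | apply cG]).
  assert (spnz : forall x, sp * x = 0 -> x = 0) by (intros x; destruct Hsp; subst sp; lra).
  assert (F0 : forall t, F t <> RtoC 0).
  { intros t H; injection H; intros H1 H2; destruct (box p Hp t) as (_ & _ & _ & N).
    exact (N (spnz _ H2) H1). }
  (* Opposite directions force [x = 0] from the first components; then [Y 0 y = - s * y] contradicts
     [cone]. *)
  assert (F'opp : forall t s, 0 <= s -> (F' t + s * F t)%C <> 0%C).
  { intros t s s0 H; destruct (box p Hp t) as (Hx & Hy & EG & N).
    unfold F', F in H; rewrite EG in H; injection H; simpl; intros H1 H2.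
    assert (x0 : fst (p t) = 0) by (apply spnz; nra).
    assert (C := cone _ _ Hx Hy); rewrite x0 in *; rewrite Rabs_R0 in C.
    specialize (N eq_refl); revert H1 C N; generalize (snd (p t)) as y; intros y H1 C N.
    assert (Y 0 y = - (s * y)) by lra.
    revert C; rewrite H0; unfold Rabs; repeat destruct Rcase_abs; nra. }
  apply (turning_compare _ F'); auto.
  + now rewrite per.
  + unfold F'; now rewrite per.
  + intros t H; apply (F'opp t 0); [lra|]; rewrite H; ring.
  (* Opposite directions force [Y = 0]; there [X] and [sp * x] have the same sign on both halves,
     because [sm = - sp]. *)
  + intros t s s0; destruct (box p Hp t) as (_ & _ & EG & _); intros H.
    unfold F' in H; rewrite EG in H; injection H; simpl; intros H1 H2.
    assert (Y1 : Y (fst (p t)) (snd (p t)) = 0) by nra.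
    assert (D := cross p Hp t Y1); revert D H2.
    generalize (X (fst (p t)) (snd (p t))) (fst (p t)).
    subst sm; intros x a D; destruct Hsp; subst sp; destruct D; nra.
  + apply (turning_compare _ F); auto.
    * unfold F'; now rewrite per.
    * unfold F; now rewrite per.
    (* [F] is [p] itself when [sp = 1] and [- Cconj p] when [sp = -1]. *)
    * destruct Hsp as [Hs|Hs].
      -- apply (turning_ext p); [|now rewrite Hs, Rmult_1_r].
         intros t; unfold F; rewrite Hs, Rmult_1_l; apply surjective_pairing.
      -- apply (turning_ext (fun t => (RtoC (-1) * Cconj (p t))%C)).
         { intros t; unfold F, Cconj, Cmult; rewrite Hs; simpl; f_equal; ring. }
         apply turning_scale.
         replace (2 * PI * sp) with (- (2 * PI)) by (rewrite Hs; ring).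
         now apply turning_conj.
Qed.

(** * Index of an isolated zero *)

Lemma lipschitz_continuous_C (f : C -> C) (z : C) (d K : R) :
  0 < d -> 0 < K ->
  (forall y, Cmod (y - z) < d -> Cmod (f y - f z) <= K * Cmod (y - z)) ->
  continuous f z.
Proof.
intros d0 K0 H; apply filterlim_locally; intros eps.
assert (e0 := cond_pos eps).
(* Balls of [C] are squares here; the factor 1/2 absorbs the [sqrt 2] between [Cmod] and the maximum
   norm. *)
assert (del : 0 < Rmin d (eps / K) / 2).
{ apply Rdiv_lt_0_compat; [|lra]; apply Rmin_glb_lt; [exact d0 | now apply Rdiv_lt_0_compat]. }
exists (mkposreal _ del); intros y [B1 B2].
change (Rabs (fst y - fst z) < Rmin d (eps / K) / 2) in B1.
change (Rabs (snd y - snd z) < Rmin d (eps / K) / 2) in B2.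
assert (N : Cmod (y - z) < Rmin d (eps / K)).
{ eapply Rle_lt_trans; [apply Cmod_2Rmax|].
  simpl; fold (fst y - fst z) (snd y - snd z).
  assert (S : sqrt 2 <= 2).
  { rewrite <- (sqrt_square 2) at 2 by lra; apply sqrt_le_1_alt; lra. }
  assert (Rmax (Rabs (fst y - fst z)) (Rabs (snd y - snd z)) < Rmin d (eps / K) / 2)
    by now apply Rmax_lub_lt.
  assert (0 <= Rmax (Rabs (fst y - fst z)) (Rabs (snd y - snd z)))
    by (eapply Rle_trans; [apply Rabs_pos | apply Rmax_l]).
  nra. }
assert (Hd := Rlt_le_trans _ _ _ N (Rmin_l _ _)).
assert (He := Rlt_le_trans _ _ _ N (Rmin_r _ _)).
assert (Q : Cmod (f y - f z) < eps).
{ apply Rle_lt_trans with (1 := H y Hd).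
  replace (pos eps) with (K * (eps / K)) by (field; lra).
  now apply Rmult_lt_compat_l. }
generalize (Rmax_Cmod (f y - f z)%C); intros M.
split; (eapply Rle_lt_trans; [|exact Q]); (eapply Rle_trans; [|exact M]);
  [apply Rmax_l | apply Rmax_r].
Qed.

Theorem theorem3p1 (U : C -> Prop) (h : C -> C) (z0 : C)
  (U_open : open U) (Uz0 : U z0) (h_analytic : analytic_on U h)
  (z0_isolated : isolated_zero (fun z => (h z - Cconj z)%C) z0) :
  (sense_reversing h z0 ->
     is_index (fun z => (h z - Cconj z)%C) z0 (-1)%Z) /\
  (sense_preserving h z0 ->
     is_index (fun z => (h z - Cconj z)%C) z0 1%Z) /\
  (singular h z0 ->
     is_index (fun z => (h z - Cconj z)%C) z0 (-1)%Z \/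
     is_index (fun z => (h z - Cconj z)%C) z0 0%Z \/
     is_index (fun z => (h z - Cconj z)%C) z0 1%Z).
Proof.
destruct z0_isolated as (f0 & rho & rho0 & nz).
destruct (analytic_strict_derivative h z0 (h_analytic z0 Uz0)) as (c & Hc).
assert (Hd : forall d, is_complex_derive h z0 d -> d = c).
{ intros d D; symmetry; now apply (strict_derivative_unique h z0). }
set (f := fun z => (h z - Cconj z)%C) in *.
change (f z0 = 0%C) in f0.
(* One radius for the remainder estimate, continuity and absence of zeros; each case picks its own
   [eps]. *)
assert (loc : forall eps, 0 < eps -> exists R0, 0 < R0 /\
  (forall z z', Cmod (z - z0) < R0 -> Cmod (z' - z0) < R0 ->
     Cmod (h z - h z' - c * (z - z')) <= eps * Cmod (z - z')) /\
  (forall z, 0 < Cmod (z - z0) < R0 -> continuous f z /\ f z <> 0%C)).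
{ intros eps e0; destruct (Hc eps e0) as (delta & d0 & D).
  exists (Rmin delta rho).
  assert (M1 := Rmin_l delta rho); assert (M2 := Rmin_r delta rho).
  split; [now apply Rmin_glb_lt|]; split.
  { intros z z' Hz Hz'; apply D; lra. }
  intros z Hz; split; [|apply nz; lra].
  apply (lipschitz_continuous_C _ _ (delta - Cmod (z - z0)) (eps + Cmod c + 1)); [lra| |].
  { generalize (Cmod_ge_0 c); lra. }
  intros y Hy.
  assert (Y : Cmod (y - z0) < delta).
  { replace (y - z0)%C with ((y - z) + (z - z0))%C by ring.
    eapply Rle_lt_trans; [apply Cmod_triangle | lra]. }
  specialize (D y z Y ltac:(lra)).
  replace (f y - f z)%C
    with ((h y - h z - c * (y - z)) + (c * (y - z) + - Cconj (y - z)))%C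
    by (unfold f; rewrite Cminus_conj; ring).
  eapply Rle_trans; [apply Cmod_triangle|].
  assert (T := Cmod_triangle (c * (y - z)) (- Cconj (y - z))).
  rewrite Cmod_mult, Cmod_opp, Cmod_conj in T; lra. }
assert (h0 : h z0 = Cconj z0).
{ replace (h z0) with (f z0 + Cconj z0)%C by (unfold f; ring); rewrite f0; ring. }
(* Since [h z0 = Cconj z0], [f] on the circle is the remainder plus the linear model
   [c * w - Cconj w] with [w = r * cis t]. *)
assert (fE : forall r t, f (circle z0 r t) =
  (h (circle z0 r t) - h z0 - c * (circle z0 r t - z0)
    + (c * (r * cis t) - Cconj (r * cis t)))%C).
{ intros r t; unfold f; rewrite h0; unfold circle; fold (cis t).
  rewrite Cplus_conj; ring. }
assert (cw : forall r, path_continuous (fun t => (r * cis t)%C)).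
{ intros r; apply path_continuous_mult;
    [apply path_continuous_const | apply path_continuous_cis]. }
assert (cis_per : cis 0 = cis (2 * PI)).
{ unfold cis; now rewrite cos_0, sin_0, cos_2PI, sin_2PI. }
assert (modw : forall r t, 0 < r -> Cmod (r * cis t) = r).
{ intros r t Hr; rewrite Cmod_mult, Cmod_cis, Cmod_R, Rabs_right; lra. }
assert (cf : forall R0, (forall z, 0 < Cmod (z - z0) < R0 -> continuous f z /\ f z <> 0%C) ->
  forall r, 0 < r < R0 -> path_continuous (fun t => f (circle z0 r t))).
{ intros R0 HR r Hr; apply (continuous_path_continuous f (circle z0 r)).
  - apply path_continuous_circle.
  - intros t; apply HR; rewrite Cmod_circle; lra. }
assert (rem : forall R0 eps, (forall z z', Cmod (z - z0) < R0 -> Cmod (z' - z0) < R0 ->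
     Cmod (h z - h z' - c * (z - z')) <= eps * Cmod (z - z')) -> forall r t, 0 < r < R0 ->
  Cmod (h (circle z0 r t) - h z0 - c * (circle z0 r t - z0)) <= eps * r).
{ intros R0 eps L r t Hr; rewrite <- (Cmod_circle z0 r t) at 3 by lra.
  apply L; [rewrite Cmod_circle; lra|].
  replace (z0 - z0)%C with (RtoC 0) by ring; rewrite Cmod_0; lra. }
split; [|split].
- intros (d & D & Hd1); apply Hd in D; subst d.
  (* Remainder and [c * w] together have modulus at most [(1 + Cmod c) / 2 * r], less than the
     modulus [r] of [- Cconj w]. *)
  destruct (loc ((1 - Cmod c) / 2)) as (R0 & R0pos & L & HR); [lra|].
  apply (is_index_of_turning f z0 R0); auto; intros r Hr.
  apply (turning_near _ (fun t => (RtoC (-1) * Cconj (r * cis t))%C)).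
  + now apply (cf R0).
  + apply path_continuous_mult; [apply path_continuous_const | now apply path_continuous_conj].
  + now rewrite circle_2PI.
  + now rewrite cis_per.
  + intros t; rewrite Cmod_mult, Cmod_conj, Cmod_R, modw, Rabs_left by lra.
    rewrite fE.
    replace (_ - RtoC (-1) * _)%C
      with ((h (circle z0 r t) - h z0 - c * (circle z0 r t - z0)) + c * (r * cis t))%C
      by (replace (RtoC (-1)) with (- RtoC 1)%C by (unfold RtoC, Copp; simpl; f_equal; ring); ring).
    eapply Rle_lt_trans; [apply Cmod_triangle|].
    rewrite (Cmod_mult c), modw by lra.
    generalize (rem R0 _ L r t Hr); nra.
  + apply turning_scale; replace (2 * PI * IZR (-1)) with (- (2 * PI)) by ring.
    apply turning_conj, turning_cis; lra.
- intros (d & D & Hd1); apply Hd in D; subst d.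
  (* Now remainder and [- Cconj w] together stay below [Cmod c * r], the modulus of [c * w]. *)
  destruct (loc ((Cmod c - 1) / 2)) as (R0 & R0pos & L & HR); [lra|].
  apply (is_index_of_turning f z0 R0); auto; intros r Hr.
  apply (turning_near _ (fun t => (c * (r * cis t))%C)).
  + now apply (cf R0).
  + apply path_continuous_mult; [apply path_continuous_const | auto].
  + now rewrite circle_2PI.
  + now rewrite cis_per.
  + intros t; rewrite Cmod_mult, modw by lra.
    rewrite fE.
    replace (_ - c * (r * cis t))%C
      with ((h (circle z0 r t) - h z0 - c * (circle z0 r t - z0)) + - Cconj (r * cis t))%C
      by ring.
    eapply Rle_lt_trans; [apply Cmod_triangle|].
    rewrite (Cmod_opp (Cconj _)), Cmod_conj, modw by lra.
    generalize (rem R0 _ L r t Hr); nra.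
  + apply turning_scale; replace (2 * PI * IZR 1) with (2 * PI) by ring.
    apply turning_cis; lra.
- intros (d & D & Hd1); apply Hd in D; subst d.
  destruct (loc (/ 2)) as (R0 & R0pos & L & HR); [lra|].
  destruct (polar_form c) as (al & Hal); rewrite Hd1, Cmult_1_l in Hal.
  (* Rotating by [e] with [e ^ 2 * c = 1] turns the linear part into [u - Cconj u]. *)
  set (e := cis (- al / 2)).
  assert (ee : (e * Cconj e)%C = RtoC 1).
  { unfold e, cis, Cconj, Cmult, RtoC; simpl; f_equal; [|ring].
    generalize (sin2_cos2 (- al / 2)); unfold Rsqr; lra. }
  assert (ece : (e * c * e)%C = RtoC 1).
  { rewrite Hal; unfold e; rewrite <- !cis_plus.
    replace (- al / 2 + al + - al / 2) with 0 by field.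
    unfold cis; now rewrite cos_0, sin_0. }
  assert (me : Cmod e = 1) by apply Cmod_cis.
  (* The outer factor [e] completes [e * c * e = 1] and also cancels the rotation inside the
     conjugate, as [e * Cconj (e * u) = Cconj u]. *)
  set (G := fun u => (e * f (z0 + e * u))%C).
  assert (mz : forall u, Cmod (z0 + e * u - z0) = Cmod u).
  { intros u; replace (z0 + e * u - z0)%C with (e * u)%C by ring.
    rewrite Cmod_mult, me; ring. }
  (* The hypotheses on [G] are needed on the disk of twice this radius, which is the one given by
     [loc]. *)
  destruct (turning_near_fold G (R0 / 2)) as (m & Hm & T).
  { unfold G; replace (z0 + e * 0)%C with z0 by ring; rewrite f0; ring. }
  { lra. }
  { intros u u' Hu Hu'.
    replace (G u - G u' - ((u - Cconj u) - (u' - Cconj u')))%C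
      with (e * (h (z0 + e * u) - h (z0 + e * u') - c * ((z0 + e * u) - (z0 + e * u'))))%C.
    - rewrite Cmod_mult, me, Rmult_1_l.
      replace (Cmod (u - u')) with (Cmod ((z0 + e * u) - (z0 + e * u'))).
      + apply L; rewrite mz; lra.
      + replace ((z0 + e * u) - (z0 + e * u'))%C with (e * (u - u'))%C by ring.
        rewrite Cmod_mult, me; ring.
    - unfold G, f; rewrite !Cplus_conj, !Cmult_conj.
      transitivity (e * (h (z0 + e * u) - h (z0 + e * u')) - (e * c * e) * (u - u'))%C; [ring|].
      rewrite ece.
      transitivity (e * (h (z0 + e * u) - h (z0 + e * u')) - (e * Cconj e) * (Cconj u - Cconj u')
        - ((u - Cconj u) - (u' - Cconj u')))%C; [rewrite ee|]; ring. }
  { intros u Hu E.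
    apply (proj2 (HR (z0 + e * u)%C ltac:(rewrite mz; lra))).
    replace (f (z0 + e * u)%C) with (Cconj e * (e * f (z0 + e * u)))%C.
    - fold (G u); rewrite E; ring.
    - transitivity (e * Cconj e * f (z0 + e * u))%C; [|rewrite ee]; ring. }
  assert (idx : forall n : Z, m = IZR n -> is_index f z0 n).
  { intros n ->; apply (is_index_of_turning f z0 (R0 / 2)); [lra| |].
    { intros z Hz; apply HR; lra. }
    intros r Hr.
    (* Thus [f] on the circle is [G] on a rotated circle, up to a constant factor of modulus 1;
       neither rotation changes the turning. *)
    assert (Gp : forall t, (e * f (circle z0 r t))%C = G (Cconj e * (r * cis t))%C).
    { intros t; unfold G; do 2 f_equal; unfold circle; fold (cis t); f_equal.
      transitivity (e * Cconj e * (r * cis t))%C; [rewrite ee|]; ring. }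
    apply (turning_ext (fun t => (Cconj e * (e * f (circle z0 r t)))%C)).
    { intros t; transitivity (e * Cconj e * f (circle z0 r t))%C; [|rewrite ee]; ring. }
    apply turning_scale.
    apply (turning_ext (fun t => G (Cconj e * (r * cis t))%C)); [intros t; now rewrite Gp|].
    apply T.
    - intros t; rewrite Cmod_mult, Cmod_conj, me, modw; lra.
    - apply path_continuous_mult; [apply path_continuous_const | auto].
    - assert (cG : path_continuous (fun t => (e * f (circle z0 r t))%C)).
      { apply path_continuous_mult; [apply path_continuous_const|].
        apply (cf R0); auto; lra. }
      destruct cG as [c1 c2]; split; intros t.
      + apply (continuity_pt_ext (fun t => fst (e * f (circle z0 r t))%C)); [|apply c1].
        intros x; now rewrite Gp.
      + apply (continuity_pt_ext (fun t => snd (e * f (circle z0 r t))%C)); [|apply c2].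
        intros x; now rewrite Gp.
    - now rewrite cis_per.
    - apply turning_scale, turning_cis; lra. }
  destruct Hm as [Hm|[Hm|Hm]]; [left | right; left | right; right]; now apply idx.
Qed.
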